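(* Let $\sigma$ be a cone and $v\in M_{\mathbb R}$. There is a valid path from a lattice point $P_1$ (of the zonotope $Z_{\mathcal X}$) to $f_\sigma(-d(v))$ if and only if there is a $w\in M_{\mathbb R}$ such that the isomorphism class of $A_w$ appears in $K_v^\bullet$ and $P_1=f_\sigma(-d(w))$. For a given valid path $\beta_J$, this $w\in M_{\mathbb R}$ fulfills $-d(w)\sim-d(v)-\sum_{\rho\in J}D_\rho$, and the degree in which $A_w$ appears in $K_v^\bullet$ is equal to the length of the path $\beta_J$.
   Context: Setting. $k$ is an algebraically closed field of characteristic $0$; $M,N$ are dual lattices of rank $n$; $\sigma\subset N_{\mathbb R}$ is a strongly convex, full-dimensional rational polyhedral cone with rays $\sigma(1)$ and primitive ray generators $u_\rho$; $R=k[\sigma^\vee\cap M]$. Conic modules and complexes. For $v\in M_{\mathbb R}$, $A_v=\operatorname{Span}_k\{x^m: m\in M\cap(\sigma^\vee+v)\}$ is the conic module and $\overset{\circ}{A}_v=\operatorname{Span}_k\{x^m: m\in M\cap(\operatorname{Int}(\sigma^\vee)+v)\}$ the open conic module (itself a conic module, equal to $A_{v+\varepsilon p}$ for $p\in \operatorname{Int}(\sigma^\vee)$, $0<\varepsilon\ll 1$). The chamber of constancy of $v$ is $\Delta_v=\{x\in M_{\mathbb R}:\lceil\langle v,u_\rho\rangle\rceil-1<\langle x,u_\rho\rangle\le\lceil\langle v,u_\rho\rangle\rceil\ \forall\rho\}$. Its open cells are the nonempty sets $\tau_J$, $J\subseteq\sigma(1)$, of those $x\in\Delta_v$ with $\langle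 x,u_\rho\rangle=\lceil\langle v,u_\rho\rangle\rceil$ exactly for $\rho\in J$; $\overset{\circ}{A}_\tau$ denotes $\overset{\circ}{A}_x$ for any $x\in\tau$. The complex $K_v^\bullet$ has degree $l$ term $\bigoplus_{\operatorname{codim}\tau=l}\overset{\circ}{A}_\tau$ over the open cells $\tau$ of $\Delta_v$, with differentials (lowering degree by one) given by signed sums of inclusions. Divisors and zonotope. $D_\rho$ ($\rho\in\sigma(1)$) are the torus-invariant divisors, $d(v)=\sum_\rho d(v)_\rho D_\rho$ with $d(v)_\rho=\lceil\langle v,u_\rho\rangle\rceil$. $\operatorname{Cl}$ is the cokernel of $M\to\bigoplus_\rho\mathbb Z D_\rho$, $m\mapsto\operatorname{div}(x^m)=\sum_\rho\langle m,u_\rho\rangle D_\rho$, and $\sim$ is linear equivalence (equality in $\operatorname{Cl}$). $f_\sigma:\bigoplus_\rho\mathbb R D_\rho\to\operatorname{Cl}_{\mathbb R}=\operatorname{Cl}\otimes\mathbb R\cong\mathbb R^{|\sigma(1)|-n}$ is the induced linear map, $\beta_\rho=f_\sigma(D_\rho)$, and $Z_{\mathcal X}=f_\sigma((-1,0]^{\sigma(1)})=\sum_\rho(-1,0]\beta_\rho$. Lattice points are points of the lattice $f_\sigma(\bigoplus_\rho\mathbb Z D_\rho)$. Paths. For lattice points $P_1,P_2\in Z_{\mathcal X}$, a path from $P_1$ to $P_2$ is a set $\beta_J=\{\beta_\rho:\rho\in J\}$, $J\subseteq\sigma(1)$, with $P_1+\sum_{\rho\in J}\beta_\rho=P_2$;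 its length is $\dim\operatorname{Span}(u_\rho:\rho\in J)$. Writing $P_2=\sum_{\rho\in\sigma(1)}\alpha_\rho\beta_\rho$ with $\alpha_\rho\in\mathbb Q$, the path is valid if $\sum_{\rho\in J}\alpha_\rho\beta_\rho$ lies in the Minkowski sum $\sum_{\rho\in J^c}\{\gamma\beta_\rho:\gamma\in(-\alpha_\rho-1,-\alpha_\rho)\}$, where $J^c=\sigma(1)\setminus J$ and an empty Minkowski sum is $\{0\}$ (this condition does not depend on the chosen $\alpha_\rho$). *)

(* Defs.v *)
From HB Require Import structures.
From mathcomp Require Import all_boot all_order all_algebra.
From mathcomp Require Import boolp classical_sets functions cardinality fsbigop.
From mathcomp Require Import reals topology normedtype.

Set Implicit Arguments.
Unset Strict Implicit.
Unset Printing Implicit Defensive.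

Import Order.TTheory GRing.Theory Num.Theory.
Import numFieldNormedType.Exports.

Local Open Scope classical_set_scope.
Local Open Scope ring_scope.

(* After a choice of dual bases, M = N = Z^n (row vectors) and the duality is
   the dot product; M_R = N_R = R^n.  Lattice points enter R^n via [toR]. *)

Section Lattices.
Context {R : realType} {n : nat}.

Definition toR {m : nat} (x : 'rV[int]_m) : 'rV[R]_m := map_mx intr x.

Definition pairing (x y : 'rV[R]_n) : R := \sum_(i < n) x 0 i * y 0 i.

Definition dual_cone (s : set 'rV[R]_n) : set 'rV[R]_n :=
  [set x | forall y, s y -> 0 <= pairing x y].

Definition is_face (s F : set 'rV[R]_n) : Prop :=
  exists2 x, dual_cone s x & F = [set y | s y /\ pairing x y = 0].

(* The linear space parallel to the affine hull of [S]. *)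
Definition is_direction_space (S : set 'rV[R]_n) (U : {vspace 'rV[R]_n}) : Prop :=
  (forall x y, S x -> S y -> x - y \in U) /\
  (forall W : {vspace 'rV[R]_n},
     (forall x y, S x -> S y -> x - y \in W) -> (U <= W)%VS).

Definition has_codim (S : set 'rV[R]_n) (l : nat) : Prop :=
  exists2 U, is_direction_space S U & (l + \dim U)%N = n.

End Lattices.

Definition primitive {n : nat} (x : 'rV[int]_n) : Prop :=
  forall (a : int) (y : 'rV[int]_n), x = a *: y -> a \is a GRing.unit.

(* k[M]: finitely supported functions M -> k, where f stands for the Laurent
   polynomial \sum_m f(m) x^m; the product is convolution. *)
Section LaurentPolynomials.
Context {k : fieldType} {n : nat}.

Definition lsupp (f : 'rV[int]_n -> k) : set 'rV[int]_n := [set m | f m != 0].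

(* Span_k {x^m : m in S} *)
Definition monomial_span (S : set 'rV[int]_n) : set ('rV[int]_n -> k) :=
  [set f | finite_set (lsupp f) /\ lsupp f `<=` S].

Definition lmul (f g : 'rV[int]_n -> k) : 'rV[int]_n -> k :=
  fun m => \sum_(a \in [set: 'rV[int]_n]) f a * g (m - a).

(* [A] and [B] are isomorphic as modules over the subring [S] of k[M]. *)
Definition module_iso (S A B : set ('rV[int]_n -> k)) : Prop :=
  exists phi : ('rV[int]_n -> k) -> ('rV[int]_n -> k),
    [/\ set_bij A B phi,
        forall f g, A f -> A g -> phi (f + g) = phi f + phi g &
        forall s f, S s -> A f -> phi (lmul s f) = lmul s (phi f)].

End LaurentPolynomials.

Section Cone.
Context {R : realType} {n r : nat}.
Variable u : 'I_r -> 'rV[int]_n.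

Definition cone : set 'rV[R]_n :=
  [set y | exists2 c : 'I_r -> R, (forall i, 0 <= c i) &
           y = \sum_(i < r) c i *: toR (u i)].

(* [cone] is strongly convex and full-dimensional, and its one-dimensional faces
   are the r distinct rays spanned by the primitive vectors u_i; sigma(1) is
   thereby identified with 'I_r. *)
Record ray_generators : Prop := RayGenerators {
  ray_primitive : forall i, primitive (u i);
  ray_inj : injective u;
  ray_face : forall i,
    is_face cone [set y | exists2 c : R, 0 <= c & y = c *: toR (u i)];
  cone_strongly_convex : forall y, cone y -> cone (- y) -> y = 0;
  cone_full_dim : <<[seq (toR (u i) : 'rV[R]_n) | i : 'I_r]>>%VS = fullv }.

(* Divisors \sum_rho a_rho D_rho are the row vectors (a_rho)_rho. *)

Definition divR (x : 'rV[R]_n) : 'rV[R]_r := \row_i pairing x (toR (u i)).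

Definition div (m : 'rV[int]_n) : 'rV[int]_r :=
  \row_i \sum_(j < n) m 0 j * u i 0 j.

Definition lin_equiv (D E : 'rV[int]_r) : Prop := exists m, D - E = div m.

Definition sumD (J : {set 'I_r}) : 'rV[int]_r := \sum_(i in J) 'e_i.

Definition dvec (v : 'rV[R]_n) : 'rV[int]_r :=
  \row_i Num.ceil (pairing v (toR (u i))).

Definition chamber (v : 'rV[R]_n) : set 'rV[R]_n :=
  [set x | forall i, (dvec v 0 i)%:~R - 1 < pairing x (toR (u i)) <= (dvec v 0 i)%:~R].

Definition cell (v : 'rV[R]_n) (J : {set 'I_r}) : set 'rV[R]_n :=
  [set x | chamber v x /\
           forall i, pairing x (toR (u i)) = (dvec v 0 i)%:~R <-> i \in J].

Definition open_cell (v : 'rV[R]_n) (tau : set 'rV[R]_n) : Prop :=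
  tau !=set0 /\ exists J, tau = cell v J.

Variable k : fieldType.

Definition sigma_dual : set 'rV[R]_n := dual_cone cone.

Definition toric_ring : set ('rV[int]_n -> k) :=
  monomial_span [set m | sigma_dual (toR m)].

Definition conic (v : 'rV[R]_n) : set ('rV[int]_n -> k) :=
  monomial_span [set m | sigma_dual (toR m - v)].

Definition open_conic (v : 'rV[R]_n) : set ('rV[int]_n -> k) :=
  monomial_span [set m | sigma_dual° (toR m - v)].

(* [A] is one of the direct summands of the degree l term of K_v.  On a cell tau,
   [open_conic x] does not depend on the choice of x in tau. *)
Definition Kv_summand (v : 'rV[R]_n) (l : nat) (A : set ('rV[int]_n -> k)) : Prop :=
  exists2 tau, open_cell v tau /\ has_codim tau l &
    exists2 x, tau x & A = open_conic x.

Definition appears_in_degree (w v : 'rV[R]_n) (l : nat) : Prop :=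
  exists2 A, Kv_summand v l A & module_iso toric_ring (conic w) A.

Definition appears (w v : 'rV[R]_n) : Prop := exists l, appears_in_degree w v l.

End Cone.

Section Zonotope.
Context {R : realType} {n r : nat} (u : 'I_r -> 'rV[int]_n).

(* [f] is the map f_sigma onto Cl_R: since Cl is the cokernel of [div], and
   tensoring is right exact, Cl_R is the cokernel of [divR u].  It is determined
   up to a unique isomorphism compatible with [f]. *)
Definition is_class_map (ClR : lmodType R) (f : {linear 'rV[R]_r -> ClR}) : Prop :=
  (forall P, exists D, f D = P) /\
  (forall D, f D = 0 <-> exists x : 'rV[R]_n, D = divR u x).

Context {ClR : lmodType R} (f : {linear 'rV[R]_r -> ClR}).

Definition beta (i : 'I_r) : ClR := f 'e_i.

Definition lattice_point (P : ClR) : Prop :=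
  exists D : 'rV[int]_r, P = f (toR D).

Definition zonotope : set ClR :=
  (f : _ -> ClR) @` [set D : 'rV[R]_r | forall i, -1 < D 0 i <= 0].

(* Paths are indexed by J, since the beta_rho need not be distinct. *)
Definition is_path (P1 P2 : ClR) (J : {set 'I_r}) : Prop :=
  P1 + \sum_(i in J) beta i = P2.

Definition path_length (J : {set 'I_r}) : nat :=
  \dim <<[seq (toR (u i) : 'rV[R]_n) | i in J]>>%VS.

Definition valid_path (P1 P2 : ClR) (J : {set 'I_r}) : Prop :=
  is_path P1 P2 J /\
  exists2 alpha : 'I_r -> rat,
    P2 = \sum_(i < r) ratr (alpha i) *: beta i &
    exists2 gamma : 'I_r -> R,
      forall i, i \notin J ->
        - ratr (alpha i) - 1 < gamma i < - ratr (alpha i) &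
      \sum_(i in J) ratr (alpha i) *: beta i =
      \sum_(i in ~: J) gamma i *: beta i.

End Zonotope.

(* Main.v *)
Require Import Defs.
From HB Require Import structures.
From mathcomp Require Import all_boot all_order all_algebra.
From mathcomp Require Import boolp classical_sets functions cardinality fsbigop.
From mathcomp Require Import reals topology normedtype.
From mathcomp Require Import ring lra.

Set Implicit Arguments.
Unset Strict Implicit.
Unset Printing Implicit Defensive.

Import Order.TTheory GRing.Theory Num.Theory.
Import numFieldNormedType.Exports.

Local Open Scope classical_set_scope.
Local Open Scope ring_scope.

(* A cell tau_J of the chamber of v contributes to K_v the conic module of the
   divisor d(v) + sum_{rho in J} D_rho, and tau_J is nonempty exactly when the
   relation defining a valid path with index set J has a solution: that relation
   lives in Cl_R, and lifting it along divR yields a point of tau_J.  Its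
   codimension is dim Span(u_rho : rho in J) since tau_J is relatively open in a
   translate of the orthogonal complement of that span.  It remains to recover
   d(w) up to linear equivalence from the isomorphism class of A_w: an isomorphism
   of conic modules is multiplication by a monomial, and every facet inequality of
   a conic module is attained at a lattice point. *)

(** * Total orders on abelian groups and the lexicographic order on Z^n *)

Section PositiveCone.
Context {V : zmodType}.

(** The strictly positive elements of a translation-invariant total order, in which [x] lies above
    [y] when [pos (x - y)]. *)
Definition positive_cone (pos : V -> Prop) : Prop :=
  [/\ ~ pos 0, forall x y, pos x -> pos y -> pos (x + y) &
      forall x, [\/ x = 0, pos x | pos (- x)]].

Lemma positive_cone_opp (pos : V -> Prop) :
  positive_cone pos -> positive_cone (fun x => pos (- x)).
Proof.
case=> p0 pD pT; split; first by rewrite oppr0.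
  by move=> x y px py; rewrite opprD; apply: pD.
by move=> x; rewrite opprK; case: (pT x) => ?; [apply: Or31 | apply: Or33 | apply: Or32].
Qed.

Lemma finite_greatest (pos : V -> Prop) (A : set V) :
    positive_cone pos -> finite_set A -> A !=set0 ->
  exists2 a, A a & forall x, A x -> x = a \/ pos (a - x).
Proof.
case=> p0 pD pT /finite_seqP[s ->]; elim: s => [[x]//|y s IHs _].
have [s0|s0] := pselect (s = [::]).
  by exists y; rewrite /= ?mem_head// => x; rewrite s0 inE => /eqP; left.
have [b bs bP] : exists2 b, b \in s & forall x, x \in s -> x = b \/ pos (b - x).
  by apply: IHs; case: (s) s0 => // z t _; exists z => /=; rewrite mem_head.
case: (pT (b - y)) => [/subr0_eq yb|py|py].
- exists b => [/=|x]; first by rewrite inE bs orbT.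
  by rewrite /= inE => /orP[/eqP->|/bP//]; left.
- exists b => [/=|x]; first by rewrite inE bs orbT.
  by rewrite /= inE => /orP[/eqP->|/bP//]; right.
exists y => [|x]; rewrite /= ?mem_head// inE => /orP[/eqP->|/bP]; first by left.
rewrite opprB in py; case=> [->|bx]; right=> //.
by have := pD _ _ py bx; rewrite addrA subrK.
Qed.

End PositiveCone.

Definition lex_positive {n : nat} (x : 'rV[int]_n) : Prop :=
  exists2 i : 'I_n, 0 < x 0 i & forall j : 'I_n, (j < i)%N -> x 0 j = 0.

Lemma lex_positive_cone (n : nat) : positive_cone (@lex_positive n).
Proof.
split.
- by case=> i; rewrite mxE ltxx.
- move=> x y [i xi x0] [j yj y0].
  have [ij|ji|/val_inj ij] := ltngtP i j.
  + exists i => [|l li]; rewrite mxE; first by rewrite y0 ?addr0.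
    by rewrite x0 ?y0 ?addr0// (ltn_trans li).
  + exists j => [|l li]; rewrite mxE; first by rewrite x0 ?add0r.
    by rewrite x0 ?y0 ?addr0// (ltn_trans li).
  + subst j; exists i => [|l li]; rewrite mxE; first exact: addr_gt0.
    by rewrite x0 ?y0 ?addr0.
- move=> x; have [/rowP x0|/existsNP[i0 /eqP xi0]] := pselect (forall i, x 0 i = (0 : 'rV_n) 0 i).
    by apply: Or31.
  rewrite mxE in xi0.
  have [i xi imin] := arg_minnP (P := fun i => x 0 i != 0) (fun i : 'I_n => i : nat) xi0.
  have x0 (j : 'I_n) : (j < i)%N -> x 0 j = 0.
    by move=> ji; apply/eqP/negP => /negP /imin; rewrite leqNgt ji.
  have [xi0'|xi_gt0] := lerP (x 0 i) 0.
    apply: Or33; exists i; first by rewrite mxE oppr_gt0 lt_neqAle xi.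
    by move=> j /x0; rewrite mxE => ->; rewrite oppr0.
  by apply: Or32; exists i.
Qed.

(** * Extremal exponents of products, and isomorphisms of modules spanned by monomials *)

Section LaurentUnits.
Context {k : fieldType} {n : nat}.
Implicit Types (f g h : 'rV[int]_n -> k) (a b e m q : 'rV[int]_n).

Definition monomial a : 'rV[int]_n -> k := fun m => (m == a)%:R.

Definition shift a f : 'rV[int]_n -> k := fun m => f (m - a).

Lemma lmul_coef1 f g m b :
  (forall a, a != b -> f a * g (m - a) = 0) -> lmul f g m = f b * g (m - b).
Proof.
move=> fg0; rewrite /lmul -(@fsbig_widen _ _ _ _ [set b] [set: 'rV[int]_n]) ?fsbig_set1//.
by move=> a /= [_ /eqP ab]; apply: fg0.
Qed.

Lemma lmul_monomiall a f : lmul (monomial a) f = shift a f.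
Proof.
apply/funext => m; rewrite (@lmul_coef1 _ _ _ a) /monomial ?eqxx ?mul1r// => b.
by move=> /negbTE ->; rewrite mul0r.
Qed.

Lemma lmul_monomialr a f : lmul f (monomial a) = shift a f.
Proof.
apply/funext => m; rewrite (@lmul_coef1 _ _ _ (m - a)) /monomial ?subKr ?eqxx ?mulr1//.
move=> b ba; case: eqP => [mba|_]; last by rewrite mulr0.
by move: ba; rewrite -mba subKr eqxx.
Qed.

Lemma shift_monomial a b : shift a (monomial b) = monomial (a + b).
Proof. by apply/funext => m; rewrite /shift /monomial subr_eq addrC. Qed.

Lemma lsupp_monomial a : lsupp (monomial a) = [set a].
Proof.
apply/seteqP; split => m; rewrite /lsupp /monomial /=; last by move=> ->; rewrite eqxx oner_eq0.
by have [//|_] := eqVneq m a; rewrite /= mulr0n eqxx.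
Qed.

Lemma monomial_spanP (S : set 'rV[int]_n) a : monomial_span S (monomial a) <-> S a.
Proof.
rewrite /monomial_span /= lsupp_monomial; split=> [[_]|Sa]; first exact.
by split=> [|_ ->//]; exact: finite_set1.
Qed.

Lemma lsupp_shift a f : lsupp (shift a f) = (fun m => a + m) @` lsupp f.
Proof.
apply/seteqP; split=> [m /= fm|_ [m fm <-]]; last by rewrite /lsupp /shift /= [a + m]addrC addrK.
by exists (m - a); rewrite // addrC subrK.
Qed.

(** Another pair of exponents with sum [a + b] would fall short of [a] and [b] by amounts that add
    up to 0, while positive elements never do. *)
Lemma lmul_extremal (pos : 'rV[int]_n -> Prop) f g a b : positive_cone pos ->
    (forall x, lsupp f x -> x = a \/ pos (a - x)) ->
    (forall x, lsupp g x -> x = b \/ pos (b - x)) ->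
  lmul f g (a + b) = f a * g b.
Proof.
case=> p0 pD _ fa gb; rewrite (@lmul_coef1 _ _ _ a) ?[a + b]addrC ?addrK// => x /eqP xa.
apply: contrapT => /eqP; rewrite mulf_eq0 negb_or => /andP[fx gx].
case: (fa _ fx) => // ax; apply: p0; case: (gb _ gx) => [|bx].
  by rewrite -[RHS]addr0 -addrA => /addrI /subr0_eq ax'; rewrite ax' in xa.
suff <- : a - x + (b - (b + a - x)) = 0 by apply: pD.
by apply/rowP => i; rewrite !mxE; ring.
Qed.

(* The greatest and the least exponents of a product are the sums of those of
   the factors, so the factors of a monomial have a single exponent. *)
Lemma monomial_factor f g e : finite_set (lsupp f) -> finite_set (lsupp g) ->
  lmul f g = monomial e -> exists b, lsupp g = [set b].
Proof.
move=> finf fing fg.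
have fg_neq0 : lmul f g e <> 0 by rewrite fg /monomial eqxx; apply/eqP/oner_neq0.
have f0 : lsupp f !=set0.
  apply: contrapT => nf; apply: fg_neq0; rewrite /lmul fsbig1// => a _.
  apply/eqP; rewrite mulf_eq0; apply/orP; left; apply: contrapT => /negP fa.
  by apply: nf; exists a.
have g0 : lsupp g !=set0.
  apply: contrapT => nf; apply: fg_neq0; rewrite /lmul fsbig1// => a _.
  apply/eqP; rewrite mulf_eq0; apply/orP; right; apply: contrapT => /negP fa.
  by apply: nf; exists (e - a).
have extr pos : positive_cone pos -> exists a b,
  [/\ a + b = e, forall x, lsupp f x -> x = a \/ pos (a - x), lsupp g b &
      forall x, lsupp g x -> x = b \/ pos (b - x)] /\ lsupp f a.
  move=> posP; have [a fa fmax] := finite_greatest posP finf f0.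
  have [b gb gmax] := finite_greatest posP fing g0.
  exists a, b; split=> //; split=> //.
  have := lmul_extremal posP fmax gmax; rewrite fg /monomial.
  case: eqP => // _ /esym/eqP; rewrite mulf_eq0 => /orP[] /eqP z.
    by move: fa; rewrite /lsupp /= z eqxx.
  by move: gb; rewrite /lsupp /= z eqxx.
have lexP := lex_positive_cone n; have [p0 pD _] := lexP.
have [a [b [[ab amax gb bmax] fa]]] := extr _ lexP.
have [a' [b' [[ab' amin gb' bmin] fa']]] := extr _ (positive_cone_opp lexP).
(* Both pairs of extremes add up to [e], so [b'] below [b] would put [a'] above the greatest
   exponent [a]. *)
have bb' : b' = b.
  case: (bmax _ gb') => // bb'; exfalso; apply: p0.
  have aa' : a' - a = b - b'.
    by apply/eqP; rewrite subr_eq addrAC -subr_eq opprK ab' addrC ab.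
  case: (amax _ fa') => [aa|/pD /(_ bb')]; last by rewrite -aa' addrA subrK subrr.
  by move: bb'; rewrite -aa' aa subrr.
exists b; apply/seteqP; split=> [x gx|_ ->//]; case: (bmax _ gx) => // bx.
case: (bmin _ gx) => [->//|]; rewrite bb' opprB => xb; exfalso; apply: p0.
by have := pD _ _ bx xb; rewrite addrA subrK subrr.
Qed.

(** Multiplication by x^e is the isomorphism; it commutes with every convolution, so [S] may be
    arbitrary. *)
Lemma module_iso_translate (e : 'rV[int]_n) (S : set ('rV[int]_n -> k))
    (A B : set 'rV[int]_n) : (forall m, A m <-> B (m + e)) ->
  module_iso S (monomial_span A) (monomial_span B).
Proof.
move=> AB; exists (shift e); split=> //.
- split.
  + move=> f [finf fA]; split; rewrite lsupp_shift; first exact: finite_image.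
    by move=> _ [m /fA /AB ? <-]; rewrite addrC.
  + move=> f g _ _ fg; apply/funext => m; have := congr1 (fun h => h (m + e)) fg.
    by rewrite /shift addrK.
  + move=> g [fing gB]; exists (shift (- e) g); last first.
      by apply/funext => m; rewrite /shift opprK subrK.
    split; rewrite lsupp_shift; first exact: finite_image.
    by move=> _ [m /gB ? <-]; apply/AB; rewrite addrC addrA subrr add0r.
- move=> s f _ _; apply/funext => m; rewrite /shift /lmul.
  by apply: eq_fsbigr => a _; rewrite addrAC.
Qed.

(* An isomorphism is multiplication by a Laurent polynomial, which divides a
   monomial by surjectivity. *)
Lemma translate_of_module_iso (C A B : set 'rV[int]_n) :
    (forall s : seq 'rV[int]_n, exists q, forall a, a \in s -> C (q + a)) ->
    A !=set0 -> B !=set0 ->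
    module_iso (monomial_span C : set ('rV[int]_n -> k)) (monomial_span A) (monomial_span B) ->
  exists e, forall m, A m <-> B (m + e).
Proof.
move=> deep [m1 Am1] [m2 Bm2] [phi [[phiAB _ phi_surj] _ phiM]].
pose h := phi (monomial m1).
have [finh _] : monomial_span B h by apply: phiAB; apply/monomial_spanP.
(* Both sides equal the image of x^(q+m1) f, read once as x^(q+m1) acting on f and once as x^q f
   acting on x^m1. The shift [q] moves [m1] and the support of [f] into [C], so that both act as
   ring elements. *)
have phiE f : monomial_span A f ->
    exists2 q, finite_set (lsupp (shift q f)) & shift (q + m1) (phi f) = lmul (shift q f) h.
  move=> Af; have [/finite_seqP[s fs] _] := Af.
  have [q qP] := deep (m1 :: s).
  have Cqf : monomial_span C (shift q f).
    split; rewrite lsupp_shift; first by apply: finite_image; apply: Af.1.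
    by move=> _ [m fm <-]; apply: qP; rewrite inE; move: fm; rewrite fs /= => ->; rewrite orbT.
  exists q; first exact: Cqf.1.
  rewrite -phiM//; last exact/monomial_spanP.
  rewrite lmul_monomialr -lmul_monomiall -phiM//; last first.
    by apply/monomial_spanP/qP; rewrite mem_head.
  congr phi; apply/funext => m; rewrite lmul_monomiall /shift; congr f.
  by rewrite addrAC opprD addrA.
have [f0 Af0 phif0] : (phi @` monomial_span A) (monomial m2) by apply/phi_surj/monomial_spanP.
have [b hb] : exists b, lsupp h = [set b].
  have [q finq] := phiE _ Af0; rewrite phif0 shift_monomial => /esym.
  exact: monomial_factor.
have h0 m : m != b -> h m = 0.
  by move=> /eqP mb; apply/eqP/negP => /negP hm; apply: mb; have : lsupp h m by []; rewrite hb.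
have hb0 : h b != 0 by have : lsupp h b by rewrite hb.
(* Since [h], the image of x^m1, is a multiple of x^b, all exponents move by [b - m1]. *)
exists (b - m1) => m; split=> [Am|Bm].
  have Af : monomial_span A (monomial m) by apply/monomial_spanP.
  have [q _] := phiE _ Af; rewrite shift_monomial lmul_monomiall.
  move=> /(congr1 (fun g => g (b + (q + m)))); rewrite /shift addrK => phim.
  have [_ ] := phiAB _ Af; apply; rewrite /lsupp /=.
  have <- : b + (q + m) - (q + m1) = m + (b - m1); last by rewrite phim.
  by apply/rowP => i; rewrite !mxE; ring.
(* The preimage [f] turns out to have a nonzero coefficient at [m], which puts [m] in [A]. *)
have [f Af phif] : (phi @` monomial_span A) (monomial (m + (b - m1))).
  exact/phi_surj/monomial_spanP.
have [q _] := phiE _ Af; rewrite phif shift_monomial.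
move=> /(congr1 (fun g => g (q + m + b))); rewrite (@lmul_coef1 _ _ _ (q + m)); last first.
  move=> x xqm; rewrite h0 ?mulr0//; apply: contra_neq xqm.
  by move=> /(canRL (subrK _)); rewrite [LHS]addrC => /addrI.
have -> : q + m1 + (m + (b - m1)) = q + m + b by apply/rowP => i; rewrite !mxE; ring.
rewrite /monomial eqxx /shift addrAC subrr add0r => /esym fm; apply: Af.2.
by apply/eqP => fm0; move: fm; rewrite fm0 mul0r => /esym/eqP; rewrite oner_eq0.
Qed.

End LaurentUnits.

(** * The dot product, orthogonal complements, scaling and rounding *)

Section Pairing.
Context {R : realType} {n : nat}.
Implicit Types x y z : 'rV[R]_n.

Lemma pairingC x y : pairing x y = pairing y x.
Proof. by apply: eq_bigr => i _; rewrite mulrC. Qed.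

Lemma pairingDl x y z : pairing (x + y) z = pairing x z + pairing y z.
Proof. by rewrite -big_split; apply: eq_bigr => i _; rewrite mxE mulrDl. Qed.

Lemma pairingZl (a : R) x z : pairing (a *: x) z = a * pairing x z.
Proof. by rewrite mulr_sumr; apply: eq_bigr => i _; rewrite mxE mulrA. Qed.

Lemma pairingNl x z : pairing (- x) z = - pairing x z.
Proof. by rewrite -scaleN1r pairingZl mulN1r. Qed.

Lemma pairingBl x y z : pairing (x - y) z = pairing x z - pairing y z.
Proof. by rewrite pairingDl pairingNl. Qed.

Lemma pairing0l z : pairing 0 z = 0.
Proof. by rewrite -(scale0r 0) pairingZl mul0r. Qed.

Lemma pairing_suml (I : Type) (s : seq I) (P : pred I) (F : I -> 'rV[R]_n) z :
  pairing (\sum_(i <- s | P i) F i) z = \sum_(i <- s | P i) pairing (F i) z.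
Proof.
by apply: (big_morph (pairing^~ z)) => [x y|]; rewrite ?pairingDl ?pairing0l.
Qed.

Lemma pairing_ge0 x : 0 <= pairing x x.
Proof. by apply: sumr_ge0 => i _; rewrite -expr2 sqr_ge0. Qed.

Lemma pairing_eq0 x : pairing x x = 0 -> x = 0.
Proof.
move=> /psumr_eq0P xx; apply/rowP => i; rewrite mxE; apply/eqP.
by rewrite -sqrf_eq0 expr2 xx// => j _; rewrite -expr2 sqr_ge0.
Qed.

Lemma pairing_gt0 x : x != 0 -> 0 < pairing x x.
Proof.
move=> x0; rewrite lt_neqAle pairing_ge0 andbT eq_sym.
by apply: contra_neq x0; exact: pairing_eq0.
Qed.

Lemma pairing_norm_le x z (e : R) :
  (forall i, `|x 0 i| <= e) -> `|pairing x z| <= e * \sum_i `|z 0 i|.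
Proof.
move=> xe; rewrite mulr_sumr; apply: le_trans (ler_norm_sum _ _ _) _.
by apply: ler_sum => i _; rewrite normrM ler_wpM2r.
Qed.

Lemma dim_row (m : nat) : \dim (fullv : {vspace 'rV[R]_m}) = m.
Proof. by rewrite dimvf dim_matrix mul1r. Qed.

(** [U] is the kernel of pairing with a basis of [S]. Positive definiteness makes [S] and [U]
    disjoint, so the dimensions add up to at most [n]; rank-nullity gives the other inequality. *)
Lemma orthogonal_complement (S : {vspace 'rV[R]_n}) :
  exists2 U : {vspace 'rV[R]_n},
    forall y, y \in U <-> forall z, z \in S -> pairing y z = 0 & (\dim S + \dim U)%N = n.
Proof.
pose B : 'M[R]_(n, \dim S) := \matrix_(j, i) (vbasis S)`_i 0 j.
pose U := lker (linfun (mulmxr B) : 'Hom('rV[R]_n, 'rV[R]_(\dim S))).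
have UP y : y \in U <-> forall z, z \in S -> pairing y z = 0.
  rewrite memv_ker lfunE /=; split=> [/eqP/rowP yB z /coord_vbasis ->|yS].
    rewrite pairingC pairing_suml big1// => i _; rewrite pairingZl pairingC.
    have := yB i; rewrite !mxE; under eq_bigr do rewrite mxE.
    by rewrite /pairing => ->; rewrite mulr0.
  apply/eqP/rowP => i; rewrite !mxE -[RHS](yS (vbasis S)`_i).
    by apply: eq_bigr => j _; rewrite mxE.
  by rewrite vbasis_mem// mem_nth// size_tuple.
exists U => //; apply/eqP; rewrite eqn_leq; apply/andP; split.
  rewrite -dimv_disjoint_sum; first by rewrite (leq_trans (dimvS (subvf _)))// dim_row.
  suff : (S :&: U <= 0)%VS by rewrite subv0 => /eqP.
  apply/subvP => x; rewrite memv_cap memv0 => /andP[xS /UP xU].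
  by apply/eqP; exact: (pairing_eq0 (xU x xS)).
have := limg_ker_dim (linfun (mulmxr B) : 'Hom('rV[R]_n, 'rV[R]_(\dim S))) fullv.
rewrite capfv dim_row => {1}<-; rewrite addnC leq_add2r.
by rewrite (leq_trans (dimvS (subvf _)))// dim_row.
Qed.

Lemma exists_small_scalar (I : finType) (a c : I -> R) : (forall i, 0 < c i) ->
  exists2 e : R, 0 < e & forall i, e * `|a i| < c i.
Proof.
(* The inverse of [s] lies below every [c i / |a i|]; the summand 1 makes this strict and keeps [s]
   positive even for empty [I]. *)
move=> c0; pose s := 1 + \sum_i `|a i| / c i.
have ac0 i : 0 <= `|a i| / c i by rewrite divr_ge0// ltW.
have s0 : 0 < s by rewrite ltr_wpDr// sumr_ge0.
exists s^-1 => [|i]; first by rewrite invr_gt0.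
rewrite mulrC ltr_pdivrMr// mulrC -ltr_pdivrMr//.
by rewrite /s (bigD1 i)//= addrCA ltrDl ltr_wpDr// sumr_ge0.
Qed.

Lemma exists_large_scalar (I : finType) (a c : I -> R) : (forall i, 0 < c i) ->
  exists N : R, forall i, a i < N * c i.
Proof.
move=> /(exists_small_scalar a)[e e0 ae]; exists e^-1 => i.
by rewrite mulrC ltr_pdivlMr// mulrC (le_lt_trans _ (ae i))// ler_pM2l// ler_norm.
Qed.

Definition floor_row x : 'rV[int]_n := \row_i Num.floor (x 0 i).

(** The bound is independent of [x], so the rounding error is absorbed once [x] is scaled far
    enough. *)
Lemma pairing_floor_row x z :
  `|pairing (toR (floor_row x)) z - pairing x z| <= \sum_i `|z 0 i|.
Proof.
rewrite -pairingBl -[leRHS]mul1r; apply: pairing_norm_le => i.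
rewrite !mxE distrC; have /andP[] := floor_itv (x 0 i); rewrite intrD => ? ?.
by rewrite ger0_norm; lra.
Qed.

End Pairing.

Lemma bezout_row {n : nat} (x : 'rV[int]_n) (s : seq 'I_n) :
  exists m : 'rV[int]_n, forall j, j \in s -> x 0 j \in dvdz (\sum_i m 0 i * x 0 i).
Proof.
elim: s => [|l s [m ms]]; first by exists 0.
pose d := \sum_i m 0 i * x 0 i.
have [a [b ab]] := Bezoutz d (x 0 l); exists (a *: m + b *: 'e_l) => j.
(* The new combination is the gcd of the old one and the new coordinate, hence divides both. *)
have -> : \sum_i (a *: m + b *: 'e_l) 0 i * x 0 i = gcdz d (x 0 l).
  rewrite -ab mulr_sumr (bigD1 l)//= [in RHS](bigD1 l)//= !mxE !eqxx/= mulr1 mulrDl.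
  rewrite -!mulrA addrAC; congr (_ + _ + _); apply: eq_bigr => i il.
  by rewrite !mxE eqxx (negbTE il) mulr0 addr0 mulrA.
rewrite inE => /orP[/eqP ->|/ms]; first exact: dvdz_gcdr.
exact/dvdz_trans/dvdz_gcdl.
Qed.

(** An integer combination of the coordinates that divides all of them can be factored out of [x],
    so primitivity makes it a unit. *)
Lemma primitive_bezout {n : nat} (x : 'rV[int]_n) :
  primitive x -> exists m : 'rV[int]_n, \sum_i m 0 i * x 0 i = 1.
Proof.
move=> px; have [m mP] := bezout_row x (enum 'I_n).
pose d := \sum_i m 0 i * x 0 i; have du : d \is a GRing.unit.
  apply: (px _ (\row_j divz (x 0 j) d)); apply/rowP => j.
  by rewrite !mxE mulrC divzK// mP// mem_enum.
exists (d^-1 *: m); rewrite -(mulVr du) mulr_sumr.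
by apply: eq_bigr => i _; rewrite mxE mulrA.
Qed.

(** * Conic modules as modules of divisors, and the facets of the dual cone *)

Section Divisors.
Context {R : realType} {n r : nat} (u : 'I_r -> 'rV[int]_n).
Implicit Types (x v w : 'rV[R]_n) (m : 'rV[int]_n) (J : {set 'I_r}) (d : 'rV[int]_r).

Local Notation "<< x | i >>" := (pairing x (toR (u i)) : R).

Lemma pairing_toR m i : << toR m | i >> = (div u m 0 i)%:~R.
Proof. by rewrite mxE rmorph_sum; apply: eq_bigr => j _; rewrite !mxE rmorphM. Qed.

Lemma divD m m' : div u (m + m') = div u m + div u m'.
Proof.
by apply/rowP => i; rewrite !mxE -big_split; apply: eq_bigr => j _; rewrite mxE mulrDl.
Qed.

Lemma divZ (a : int) m : div u (a *: m) = a *: div u m.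
Proof.
by apply/rowP => i; rewrite !mxE mulr_sumr; apply: eq_bigr => j _; rewrite mxE mulrA.
Qed.

Lemma div0 : div u 0 = 0.
Proof. by apply/rowP => i; rewrite !mxE big1// => j _; rewrite mxE mul0r. Qed.

Lemma divR_toR m : divR u (toR m) = toR (div u m) :> 'rV[R]_r.
Proof. by apply/rowP => i; rewrite [LHS]mxE pairing_toR [RHS]mxE. Qed.

Lemma sumDE J i : sumD J 0 i = (i \in J)%:R.
Proof.
rewrite /sumD summxE; under eq_bigr do rewrite mxE eqxx /=.
have [iJ|iJ] := boolP (i \in J).
  rewrite (bigD1 i)//= eqxx big1 ?addr0// => j /andP[_]; rewrite eq_sym => /negbTE -> //.
by rewrite big1// => j jJ; case: eqP => // ij; rewrite ij jJ in iJ.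
Qed.

Lemma sigma_dualP x : sigma_dual u x <-> forall i, 0 <= << x | i >>.
Proof.
split=> [xd i|xu _ [c c0 ->]].
  apply: xd; exists (fun j => (j == i)%:R) => [j|]; first exact: ler0n.
  by rewrite (bigD1 i)//= eqxx scale1r big1 ?addr0// => j /negbTE ->; rewrite scale0r.
rewrite pairingC pairing_suml sumr_ge0// => i _.
by rewrite pairingZl pairingC mulr_ge0.
Qed.

(** The exponents of the global sections of O(-d). *)
Definition effective_above d : set 'rV[int]_n := [set m | forall i, d 0 i <= div u m 0 i].

(** Lattice points pair integrally with [u i], so each lower bound may be rounded up. *)
Lemma conicE (k : fieldType) w :
  conic u w = monomial_span (effective_above (dvec u w)) :> set (_ -> k).
Proof.
congr monomial_span; apply/seteqP; split=> m /=; rewrite sigma_dualP => wm i.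
  by have := wm i; rewrite pairingBl subr_ge0 pairing_toR [dvec u w 0 i]mxE ceil_le_int.
by have := wm i; rewrite pairingBl subr_ge0 pairing_toR [dvec u w 0 i]mxE ceil_le_int.
Qed.

Lemma toric_ringE (k : fieldType) :
  @toric_ring R n r u k = monomial_span (effective_above 0) :> set (_ -> k).
Proof.
congr monomial_span; apply/seteqP; split=> m /=; rewrite sigma_dualP => wm i.
  by have := wm i; rewrite pairing_toR [(0 : 'rV_r) 0 i]mxE ler0z.
by have := wm i; rewrite pairing_toR [(0 : 'rV_r) 0 i]mxE ler0z.
Qed.

Hypothesis hu : @ray_generators R n r u.

Lemma ray_generator_neq0 i : toR (u i) != 0 :> 'rV[R]_n.
Proof.
apply/eqP => ui0; have [m m1] := primitive_bezout (@ray_primitive _ _ _ _ hu i).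
have := pairing_toR m i; rewrite pairingC ui0 pairing0l mxE m1 => /eqP.
by rewrite eq_sym oner_eq0.
Qed.

(** From an interior point a small step against [u i] stays in the dual cone and strictly lowers the
    [i]-th pairing. Conversely, small perturbations keep finitely many positive pairings
    nonnegative. *)
Lemma interior_sigma_dualP x : (sigma_dual u)° x <-> forall i, 0 < << x | i >>.
Proof.
split=> [/nbhs_ballP[e /= e0 xe] i|x0].
  have [d d0 dP] := exists_small_scalar (fun j => toR (u i) 0 j : R) (fun=> e0).
  have /xe /sigma_dualP/(_ i) : ball x e (x - d *: toR (u i)).
    split=> // l j; rewrite ord1 /ball /= !mxE opprB addrC subrK normrM gtr0_norm//.
    by have := dP j; rewrite mxE.
  rewrite pairingBl pairingZl subr_ge0; apply: lt_le_trans.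
  by rewrite mulr_gt0// pairing_gt0// ray_generator_neq0.
have [e e0 eP] := exists_small_scalar (fun i => \sum_j `|toR (u i) 0 j : R|) x0.
apply/nbhs_ballP; exists e => // y xy; apply/sigma_dualP => i.
have xyi : `|<< x - y | i >>| <= e * \sum_j `|toR (u i) 0 j : R|.
  by apply: pairing_norm_le => j; have := xy.2 0 j; rewrite /ball /= !mxE => /ltW.
have ui0 : 0 <= \sum_j `|toR (u i) 0 j : R| by exact: sumr_ge0.
have /= := eP i; rewrite (ger0_norm ui0) => /(le_lt_trans xyi).
by rewrite pairingBl ltr_norml; lra.
Qed.

(** The functional cutting out the ray of [u i] works: if it vanished at another [u j], that
    generator would lie on the same ray, and primitivity would make the two equal. *)
Lemma facet_normal i :
  exists2 x, << x | i >> = 0 & forall j, j != i -> 0 < << x | j >>.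
Proof.
have [x xd /seteqP[xi xj]] := ray_face hu i.
have [_ x0] : cone u (toR (u i) : 'rV[R]_n) /\ pairing x (toR (u i)) = 0.
  by apply: (xi (toR (u i))); exists 1; rewrite ?ler01// scale1r.
exists x => // j ji; rewrite lt_neqAle; apply/andP; split; last exact: ((sigma_dualP x).1 xd j).
apply/eqP => /esym xj0; have [c c0 uj] : exists2 c : R, 0 <= c & toR (u j) = c *: toR (u i).
  apply: (xj (toR (u j))); split=> //; exists (fun l => (l == j)%:R) => [l|]; first exact: ler0n.
  by rewrite (bigD1 j)//= eqxx scale1r big1 ?addr0// => l /negbTE ->; rewrite scale0r.
(* Pairing with an [m] that takes the value 1 on [u i] shows that the ratio [c] is an integer. *)
have [m m1] := primitive_bezout (@ray_primitive _ _ _ _ hu i).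
have cE : c = (div u m 0 j)%:~R.
  rewrite -pairing_toR pairingC uj pairingZl pairingC pairing_toR.
  by rewrite [div _ _ _ _]mxE m1 mulr1.
have uji : u j = div u m 0 j *: u i.
  apply/rowP => l; apply/eqP; rewrite -(eqr_int R); apply/eqP.
  by have /rowP/(_ l) := uj; rewrite !mxE cE rmorphM /= !mxE.
have := ray_primitive hu uji; move: uji c0; rewrite cE ler0z.
set a := div u m 0 j => uji a0 ua.
have a1 : a = 1 by move: ua; rewrite qualifE /=; case: (a) a0 => // -[|[|?]].
by move: ji; rewrite (ray_inj hu (_ : u j = u i)) ?eqxx// uji a1 scale1r.
Qed.

Lemma interior_normal : exists p, forall i, 0 < << p | i >>.
Proof.
(* The sum of all facet normals is positive on [u j] only if a ray other than [j] exists, so fewer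
   than two rays are treated apart. *)
have [i0|i0] := pselect (exists i j : 'I_r, i != j); last first.
  have [i1|i1] := pselect (exists i : 'I_r, true); last first.
    by exists 0 => i; exfalso; apply: i1; exists i.
  case: i1 => i _; exists (toR (u i)) => j.
  have -> : j = i by apply: contrapT => /eqP ji; apply: i0; exists j, i.
  by rewrite pairing_gt0// ray_generator_neq0.
have /choice[x xP] : forall i, exists x, << x | i >> = 0 /\ forall j, j != i -> 0 < << x | j >>.
  by move=> i; have [x] := facet_normal i; exists x.
have x_ge0 i j : 0 <= << x i | j >>.
  have [->|ji] := eqVneq j i; first by rewrite (xP i).1.
  exact/ltW/(xP i).2.
exists (\sum_i x i) => j; rewrite pairing_suml.
have [i ij] : exists i, i != j.
  have [a [b ab]] := i0; have [aj|] := eqVneq a j; last by exists a.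
  by exists b; rewrite -aj eq_sym.
rewrite (bigD1 i)//= ltr_wpDr ?sumr_ge0//; apply: (xP i).2.
by rewrite eq_sym.
Qed.

(** A far multiple of an interior point satisfies all bounds even after rounding. *)
Lemma exists_effective_above d : effective_above d !=set0.
Proof.
have [p p0] := interior_normal.
have [N NP] := exists_large_scalar (fun i => (d 0 i)%:~R + \sum_j `|toR (u i) 0 j : R|) p0.
exists (floor_row (N *: p)) => i; rewrite -(ler_int R) -pairing_toR.
have := NP i; have := pairing_floor_row (N *: p) (toR (u i)).
by rewrite pairingZl ler_norml => /andP[]; lra.
Qed.

Lemma effective_above_tight d i : exists2 m, effective_above d m & div u m 0 i = d 0 i.
Proof.
have [x x0 xj] := facet_normal i.
have [q q1] := primitive_bezout (@ray_primitive _ _ _ _ hu i).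
have qi : div u q 0 i = 1 by rewrite mxE.
pose s j := \sum_l `|toR (u j) 0 l : R|.
(* A far point of the facet [i] is rounded, then its [i]-th value is corrected exactly by a multiple
   of [q]. The three summands pay for the bound at [j], the rounding error, and this correction. *)
pose a j := (d 0 j)%:~R + s j + (`|(d 0 i)%:~R| + s i) * `|(div u q 0 j)%:~R| : R.
(* The value 1 at [i] is a placeholder that meets the positivity condition where the pairing
   vanishes. *)
have c0 j : 0 < (if j == i then 1 else << x | j >>) by case: ifP => // /negbT /xj.
have [N NP] := exists_large_scalar a c0.
pose t := floor_row (N *: x); have tP j : `|(div u t 0 j)%:~R - N * << x | j >>| <= s j.
  by rewrite -pairing_toR -pairingZl; exact: pairing_floor_row.
exists (t + (d 0 i - div u t 0 i) *: q); last first.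
  by rewrite divD divZ [LHS]mxE [X in _ + X]mxE qi mulr1 addrC subrK.
move=> j; rewrite divD divZ [leRHS]mxE [X in _ <= _ + X]mxE.
have [->|ji] := eqVneq j i; first by rewrite qi mulr1 addrC subrK.
rewrite -(ler_int R) rmorphD rmorphM rmorphB /=.
have := NP j; rewrite (negbTE ji) /a => Nj.
have := tP j; rewrite ler_norml => /andP[tj _].
have := tP i; rewrite x0 mulr0 subr0 => ti.
have : `|((d 0 i)%:~R - (div u t 0 i)%:~R) * (div u q 0 j)%:~R|
    <= (`|(d 0 i)%:~R| + s i) * `|(div u q 0 j)%:~R| :> R.
  by rewrite normrM ler_wpM2r// (le_trans (ler_normB _ _))// lerD2l.
by rewrite ler_norml => /andP[]; lra.
Qed.

End Divisors.

(** * Cells of a chamber: their modules, divisors and codimensions *)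

Section Cells.
Context {R : realType} {n r : nat} (u : 'I_r -> 'rV[int]_n).
Hypothesis hu : @ray_generators R n r u.
Implicit Types (v w x : 'rV[R]_n) (J : {set 'I_r}).

Local Notation "<< x | i >>" := (pairing x (toR (u i)) : R).

Lemma cellP v J x : cell u v J x <->
  forall i, if i \in J then << x | i >> = (dvec u v 0 i)%:~R
            else (dvec u v 0 i)%:~R - 1 < << x | i >> < (dvec u v 0 i)%:~R.
Proof.
split=> [[xv xJ] i|xJ].
  case: ifP => [/xJ//|iJ]; have /andP[-> /=] := xv i.
  by rewrite le_eqVlt => /orP[/eqP/xJ|//]; rewrite iJ.
split=> i; have := xJ i; case: ifP => iJ.
- by move=> ->; rewrite lexx andbT; lra.
- by move=> /andP[-> /ltW].
- by split.
- by move=> /andP[_ xi]; split=> // xi'; rewrite xi' ltxx in xi.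
Qed.

(** For integers, exceeding the integral value of [x] on [J] means reaching the next integer;
    elsewhere [x] lies strictly below its ceiling, and exceeding it means reaching that ceiling. *)
Lemma open_conicE (k : fieldType) v J x : cell u v J x ->
  open_conic u x = monomial_span (effective_above u (dvec u v + sumD J)) :> set (_ -> k).
Proof.
move=> /cellP xJ; rewrite /open_conic; congr monomial_span.
have mP m i : (dvec u v + sumD J) 0 i <= div u m 0 i <-> 0 < << toR m - x | i >>.
  rewrite mxE sumDE pairingBl subr_gt0 pairing_toR; have := xJ i; case: ifP => _.
    by move=> ->; rewrite ltr_int lezD1.
  rewrite addr0 => /andP[x1 x2]; split=> [dm|xm].
    by apply: lt_le_trans x2 _; rewrite ler_int.
  by have := lt_trans x1 xm; rewrite -[1]/(1%:~R) -intrB ltr_int ltrBlDr ltzD1.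
apply/seteqP; split=> m /=.
  by move=> /(interior_sigma_dualP hu) mx i; apply/mP.
by move=> mx; apply/(interior_sigma_dualP hu) => i; apply/mP.
Qed.

Lemma cell_dvec v J x : cell u v J x -> exists w, dvec u w = dvec u v + sumD J.
Proof.
move=> /cellP xJ; have [p p0] := interior_normal hu.
(* A small push into the interior raises the ceilings on [J] by exactly one, given steps below 1,
   and preserves the others. *)
have [i|e e0 eP] := @exists_small_scalar R _ (fun i => << p | i >>)
    (fun i => if i \in J then 1 else (dvec u v 0 i)%:~R - << x | i >>).
  by have := xJ i; case: ifP => // _ /andP[_]; rewrite subr_gt0.
exists (x + e *: p); apply/rowP => i; rewrite [LHS]mxE [RHS]mxE sumDE; apply: ceil_def.
rewrite pairingDl pairingZl; have := xJ i; have /= := eP i.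
rewrite gtr0_norm// rmorphB rmorphD /=; have : 0 < e * << p | i >> by rewrite mulr_gt0.
by case: ifP => _; rewrite /= ?mulr1n ?mulr0n; lra.
Qed.

Lemma cell_codim v J : cell u v J !=set0 ->
  has_codim (cell u v J) (@path_length R n r u J).
Proof.
move=> [x xJ]; rewrite /path_length; set S := <<_>>%VS.
have [U UP SU] := orthogonal_complement S.
have UJ y : y \in U <-> forall i, i \in J -> << y | i >> = 0.
  rewrite UP; split=> [yS i iJ|yJ z].
    by apply: yS; apply: memv_span; apply/mapP; exists i; rewrite ?mem_enum.
  (* Orthogonality to a whole span is checked on generators by placing the span inside the
     complement of the line through [y]. *)
  have [W WP _] := orthogonal_complement <[y]>%VS.
  suff /subvP SW : (S <= W)%VS.
    by move=> /SW /WP/(_ y (memv_line y)); rewrite pairingC.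
  apply/span_subvP => _ /mapP[i + ->]; rewrite mem_enum => iJ; apply/WP => _ /vlineP[a ->].
  by rewrite pairingC pairingZl yJ// mulr0.
exists U => //; split=> [y z /cellP yJ /cellP zJ|W WJ].
  apply/UJ => i iJ; rewrite pairingBl.
  by have := yJ i; have := zJ i; rewrite iJ => -> ->; rewrite subrr.
apply/subvP => y /UJ yJ.
(* Moving [x] by [e *: y] keeps it in the cell: pairings on [J] do not change, and the others keep
   clear of both walls. On [J] the 1 is a placeholder. *)
have [i|e e0 eP] := @exists_small_scalar R _ (fun i => << y | i >>)
    (fun i => if i \in J then 1 else Num.min ((dvec u v 0 i)%:~R - << x | i >>)
       (<< x | i >> - ((dvec u v 0 i)%:~R - 1))).
  have /cellP/(_ i) := xJ; case: ifP => // _ /andP[? ?].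
  by rewrite lt_min !subr_gt0; apply/andP.
have xyJ : cell u v J (e *: y + x).
  apply/cellP => i; rewrite pairingDl pairingZl; have /cellP/(_ i) := xJ.
  have /= := eP i; case: ifP => [iJ _ ->|iJ]; first by rewrite yJ// mulr0 add0r.
  have := ler_norm (e * << y | i >>); have := ler_norm (- (e * << y | i >>)).
  by rewrite normrN normrM gtr0_norm// lt_min => ? ? /andP[? ?] /andP[? ?]; lra.
have := WJ _ _ xyJ xJ; rewrite addrK => /(memvZ e^-1).
by rewrite scalerA mulVf ?scale1r// gt_eqF.
Qed.

Lemma iso_open_conic (k : fieldType) v J x w (m : 'rV[int]_n) : cell u v J x ->
  dvec u v + sumD J = dvec u w + div u m ->
  module_iso (@toric_ring R n r u k) (conic u w) (open_conic u x).
Proof.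
move=> xJ wm; rewrite (open_conicE _ xJ) conicE; apply: (module_iso_translate (e := m)) => m'.
by rewrite wm; split=> + i => /(_ i); rewrite divD !mxE lerD2r.
Qed.

Lemma open_conic_iso_dvec (k : fieldType) v J x w : cell u v J x ->
  module_iso (@toric_ring R n r u k) (conic u w) (open_conic u x) ->
  exists m : 'rV[int]_n, dvec u v + sumD J = dvec u w + div u m.
Proof.
move=> xJ; rewrite toric_ringE conicE (open_conicE _ xJ) => /translate_of_module_iso[].
- move=> s; have [q qP] := exists_effective_above hu
    (\row_i \sum_(a <- s) `|div u a 0 i|).
  exists q => a sa i; rewrite divD [leRHS]mxE [leLHS]mxE.
  have := qP i; rewrite [leLHS]mxE (big_rem a)//=.
  have : 0 <= \sum_(y <- rem a s) `|div u y 0 i| by apply: sumr_ge0.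
  have : - `|div u a 0 i| <= div u a 0 i by rewrite lerNl -normrN ler_norm.
  by lra.
- exact: (exists_effective_above hu).
- exact: (exists_effective_above hu).
(* Translation by [m] matches the two exponent sets; a point attaining the [i]-th bound of either
   set gives one of the two inequalities. *)
move=> m mP; exists m; apply/rowP => i; rewrite [RHS]mxE; apply/eqP.
rewrite eq_le; apply/andP; split.
  have [a /mP/(_ i) + <-] := effective_above_tight hu (dvec u w) i.
  by rewrite divD [X in _ <= X -> _]mxE.
have [a ad ai] := effective_above_tight hu (dvec u v + sumD J) i.
have /mP/(_ i) : effective_above u (dvec u v + sumD J) (a - m + m) by rewrite subrK.
move=> adi; rewrite -ai -{1}(subrK m a) divD [leRHS]mxE lerD2r.
exact: adi.
Qed.

(** * The class map and valid paths *)

Context {ClR : lmodType R} (f : {linear 'rV[R]_r -> ClR}).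
Hypothesis hf : @is_class_map R n r u ClR f.

Lemma class_div (m : 'rV[int]_n) : f (toR (div u m)) = 0.
Proof. by apply/(hf.2 _).2; exists (toR m); rewrite divR_toR. Qed.

Lemma toRD (m : nat) (x y : 'rV[int]_m) : toR (x + y) = toR x + toR y :> 'rV[R]_m.
Proof. exact: map_mxD. Qed.

Lemma toRN (m : nat) (x : 'rV[int]_m) : toR (- x) = - toR x :> 'rV[R]_m.
Proof. exact: map_mxN. Qed.

Lemma class_sum (P : pred 'I_r) (a : 'I_r -> R) :
  \sum_(i | P i) a i *: beta f i = f (\row_i (if P i then a i else 0)).
Proof.
rewrite [X in f X]row_sum_delta linear_sum big_mkcond; apply: eq_bigr => i _.
by rewrite linearZ /= mxE; case: ifP => // _; rewrite scale0r.
Qed.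

Lemma class_sumD J : f (toR (sumD J)) = \sum_(i in J) beta f i.
Proof.
under eq_bigr do rewrite -[beta f _]scale1r.
rewrite class_sum; congr (f _); apply/rowP => i; rewrite [LHS]mxE [RHS]mxE sumDE.
by case: ifP.
Qed.

Lemma valid_pathP P1 v J :
  valid_path f P1 (f (toR (- dvec u v))) J <->
  is_path f P1 (f (toR (- dvec u v))) J /\ cell u v J !=set0.
Proof.
split=> [[pJ [alpha aE [gamma gP gE]]]|[pJ [x /cellP xJ]]]; split=> //.
- rewrite class_sum in aE; rewrite !class_sum in gE.
  move/eqP: gE; rewrite -subr_eq0 -linearB => /eqP/(hf.2 _).1[y yE].
  move/eqP: aE; rewrite -subr_eq0 -linearB => /eqP/(hf.2 _).1[z zE].
  (* At this point the pairing is [dvec u v 0 i] on [J], and [dvec u v 0 i] plus alpha and gamma off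
     [J], where the range of gamma is the open unit interval of the cell. *)
  exists (- (y + z)); apply/cellP => i.
  have := congr1 (fun D : 'rV_r => D 0 i) yE; have := congr1 (fun D : 'rV_r => D 0 i) zE.
  rewrite /divR toRN !mxE inE pairingNl pairingDl.
  case: ifP => iJ; first by rewrite /= => <- <-; lra.
  by have := gP i; rewrite iJ /= => /(_ isT) gi <- <-; lra.
(* Taking the coefficients of -d(v) as alpha, the pairings of [x] themselves serve as gamma, and
   [- x] witnesses the relation. *)
exists (fun i => - (dvec u v 0 i)%:~R).
  rewrite class_sum; congr (f _); apply/rowP => i.
  by rewrite toRN [LHS]mxE [X in - X]mxE [RHS]mxE /= [RHS]rmorphN /= ratr_int.
exists (fun i => << x | i >>) => [i iJ|].
  by have := xJ i; rewrite (negbTE iJ) rmorphN /= ratr_int; lra.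
rewrite !class_sum; apply/eqP; rewrite -subr_eq0 -linearB; apply/eqP/(hf.2 _).2.
exists (- x); apply/rowP => i; have := xJ i; rewrite !mxE inE pairingNl.
by case: ifP => /= _; rewrite ?subr0 ?sub0r// => ->; rewrite rmorphN /= ratr_int.
Qed.

Lemma is_pathP P1 v J : is_path f P1 (f (toR (- dvec u v))) J <->
  P1 = f (toR (- (dvec u v + sumD J))).
Proof.
rewrite /is_path -class_sumD opprD toRD linearD [toR (- sumD J)]toRN linearN.
by split=> [<-|->]; rewrite ?addrK ?subrK.
Qed.

Lemma class_dvec v w J (m : 'rV[int]_n) : dvec u v + sumD J = dvec u w + div u m ->
  f (toR (- (dvec u v + sumD J))) = f (toR (- dvec u w)).
Proof.
by move=> ->; rewrite opprD toRD linearD [toR (- div u m)]toRN linearN /= class_div subr0.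
Qed.

Lemma cell_appears (k : fieldType) v w J (m : 'rV[int]_n) :
  cell u v J !=set0 -> dvec u v + sumD J = dvec u w + div u m ->
  appears_in_degree u k w v (@path_length R n r u J).
Proof.
move=> J0 wm; have [x xJ] := J0; exists (open_conic u x); last exact: iso_open_conic wm.
exists (cell u v J); last by exists x.
by split; [split=> //; exists J | exact: cell_codim].
Qed.

End Cells.

(** * Valid paths and the summands of the complex *)

Theorem proposition1p4 (k : closedFieldType) (char0 : [pchar k] =i pred0)
    (R : realType) (n r : nat)
    (u : 'I_r -> 'rV[int]_n) (hu : @ray_generators R n r u)
    (ClR : lmodType R) (f : {linear 'rV[R]_r -> ClR})
    (hf : @is_class_map R n r u ClR f)
    (v : 'rV[R]_n)
    (P1 : ClR) (P1_lattice : lattice_point f P1) (P1_zonotope : zonotope f P1) :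
  ((exists J : {set 'I_r}, valid_path f P1 (f (toR (- dvec u v))) J) <->
   (exists w : 'rV[R]_n, appears u k w v /\ P1 = f (toR (- dvec u w)))) /\
  (forall J : {set 'I_r}, valid_path f P1 (f (toR (- dvec u v))) J ->
   (exists w : 'rV[R]_n,
      [/\ appears u k w v,
          P1 = f (toR (- dvec u w)) &
          lin_equiv u (- dvec u w) (- dvec u v - sumD J)]) /\
   (forall w : 'rV[R]_n,
      appears u k w v ->
      P1 = f (toR (- dvec u w)) ->
      lin_equiv u (- dvec u w) (- dvec u v - sumD J) ->
      appears_in_degree u k w v (@path_length R n r u J))).
Proof.
have path_appears J : valid_path f P1 (f (toR (- dvec u v))) J -> exists w : 'rV[R]_n,
    [/\ appears u k w v, P1 = f (toR (- dvec u w)) &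
        lin_equiv u (- dvec u w) (- dvec u v - sumD J)].
  move=> /(valid_pathP hf)[/is_pathP P1E [x xJ]]; have [w wE] := cell_dvec hu xJ.
  (* This [w] realises the divisor of the cell on the nose, so the trivial translation suffices. *)
  have wm : dvec u v + sumD J = dvec u w + div u 0.
    by rewrite div0 addr0.
  exists w; split; last by exists 0; rewrite wE opprD subrr div0.
    by exists (@path_length R n r u J); apply: cell_appears wm => //; exists x.
  by rewrite P1E wE.
split; first split=> [[J /path_appears[w [wv P1w _]]]|]; first by exists w.
  move=> [w [[l [_ [tau [[tau0 [J tauJ]] _] [x xtau ->]] wx]] P1E]].
  rewrite tauJ in xtau; exists J; apply/(valid_pathP hf); split; last by exists x.
  (* The isomorphism fixes d(w) up to a principal divisor, which [f] kills, so [P1] is the start of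
     the path indexed by [J]. *)
  have [m wm] := open_conic_iso_dvec hu xtau wx.
  by apply/is_pathP; rewrite (class_dvec hf wm).
move=> J vJ; split; first exact: path_appears.
move=> w _ _ [m wm]; have [_ J0] := (valid_pathP hf _ _ _).1 vJ.
apply: (cell_appears hu k (m := m) J0).
by rewrite -wm -(opprD (dvec u v)) opprK addrA subrr add0r.
Qed.
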